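(* Let $\Gamma$ be a group, $R$ a $\Gamma$-graded ring, $\gamma\in C_\Gamma(\Gamma_R)$, $\delta\in\mathrm{Der}_\gamma(R)$, and let $A$ be a $\Gamma$-graded ring. (1) If $A\approx_{\mathrm{gs}}R[t;\delta]$, then $A$ is gr-simple (resp. gr-prime) if and only if $R[t;\delta]$ is gr-simple (resp. gr-prime). (2) If $A\approx_{\mathrm{gs}}R[t;\delta]$ arises from a full idempotent $\ell\in R_e$ with $\delta(\ell)=0$ (that is, $A\cong_{\mathrm{gr}}\ell R[t;\delta]\ell$ for such an $\ell$), then $A\cong_{\mathrm{gr}}(\ell R\ell)[t;\bar\delta]$, where $\bar\delta(s):=\ell\delta(s)\ell$ for $s\in\ell R\ell$.
   Context: Rings are associative with identity; $\Gamma$ is a (not necessarily abelian) group with identity $e$. A ring $R$ is $\Gamma$-graded if $R=\bigoplus_{\sigma\in\Gamma}R_\sigma$ with $R_\sigma R_\tau\subseteq R_{\sigma\tau}$ and $1_R\in R_e$; its support is $\Gamma_R=\{\sigma:R_\sigma\neq0\}$, and $C_\Gamma(\Gamma_R)$ is the centralizer of $\Gamma_R$ in $\Gamma$. $\cong_{\mathrm{gr}}$ denotes existence of a bijective ring homomorphism preserving each homogeneous component. $\mathrm{Der}_\gamma(R)$ is the set of additive maps $\delta:R\to R$ with $\delta(xy)=\delta(x)y+x\delta(y)$ and $\delta(R_\tau)\subseteq R_{\tau\gamma}$ for all $\tau\in\Gamma_R$. $R[t;\delta]$ is the free left $R$-module on $\{t^k\}_{k\ge0}$ with multiplication determined by $tx=xt+\delta(x)$,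 graded by $R[t;\delta]_\tau=\bigoplus_{i\ge0}R_{\tau\gamma^{-i}}t^i$. For a $\Gamma$-graded ring $A$, $M_\infty(A)$ is the (nonunital) ring of $\mathbb{N}\times\mathbb{N}$ matrices over $A$ with finitely many nonzero entries, and $M_n(A)$, $M_\infty(A)$ carry the standard gradings $M_n(A)_\sigma=M_n(A_\sigma)$, $M_\infty(A)_\sigma=M_\infty(A_\sigma)$. Graded rings $A,B$ are graded stably isomorphic, $A\approx_{\mathrm{gs}}B$, if $M_\infty(A)\cong_{\mathrm{gr}}M_\infty(B)$; equivalently, $A\cong_{\mathrm{gr}}\ell M_n(B)\ell$ for some $n$ and some full idempotent $\ell\in M_n(B)_e$. An idempotent $\ell\in B_e$ is full if $B_e\ell B_e=B_e$ (additive span of products). For an idempotent $\ell\in B_e$ the corner $\ell B\ell$ has identity $\ell$ and grading $(\ell B\ell)_\tau=\ell B_\tau\ell$. When $\delta(\ell)=0$, $\bar\delta\in\mathrm{Der}_\gamma(\ell R\ell)$, and $(\ell R\ell)[t;\bar\delta]$ is graded by the same formula with $\deg(t)=\gamma$. A graded ring is gr-simple if its only graded two-sided ideals (those containing the homogeneous components of their elements) are $0$ and the whole ring; a graded ring $A$ is gr-prime if for homogeneous $x,y$, $xAy=0$ forces $x=0$ or $y=0$. *)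

(* Defs.v *)
From HB Require Import structures.
From mathcomp Require Import all_boot all_order all_algebra.
From mathcomp Require Import finmap.
From mathcomp.multinomials Require Import monalg.

Set Implicit Arguments.
Unset Strict Implicit.
Unset Printing Implicit Defensive.

Import GRing.Theory.
Local Open Scope ring_scope.

(* Rings are [pzRingType]s, so the zero ring is allowed; the group is an
   arbitrary, possibly infinite and nonabelian, [groupType].  The last two
   axioms say that R is the internal direct sum of the components. *)
HB.mixin Record isGraded (Gamma : groupType) R of GRing.PzRing R := {
  grcomp : Gamma -> R -> Prop;
  grcomp0 : forall sigma, grcomp sigma 0;
  grcompB : forall sigma x y,
    grcomp sigma x -> grcomp sigma y -> grcomp sigma (x - y);
  grcompM : forall sigma tau x y,
    grcomp sigma x -> grcomp tau y -> grcomp (sigma * tau)%g (x * y);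
  grcomp1 : grcomp 1%g 1;
  grcomp_span : forall x, exists s : seq (Gamma * R),
    (forall p, p \in s -> grcomp p.1 p.2) /\ x = \sum_(p <- s) p.2;
  grcomp_indep : forall (s : seq Gamma) (f : Gamma -> R), uniq s ->
    (forall sigma, sigma \in s -> grcomp sigma (f sigma)) ->
    \sum_(sigma <- s) f sigma = 0 -> forall sigma, sigma \in s -> f sigma = 0
}.

#[short(type="grRingType")]
HB.structure Definition GradedRing (Gamma : groupType) :=
  { R of isGraded Gamma R & GRing.PzRing R }.

Section GradedNotions.
Variable Gamma : groupType.
Implicit Types R A B : grRingType Gamma.

Definition grsupp R (sigma : Gamma) : Prop :=
  exists2 x : R, grcomp sigma x & x <> 0.

Definition centralizes_grsupp R (gamma : Gamma) : Prop :=
  forall sigma, grsupp R sigma -> commute gamma sigma.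

Definition homogeneous R (x : R) : Prop := exists sigma : Gamma, grcomp sigma x.

(* The terms f sigma are the homogeneous components of their sum. *)
Definition graded_ideal R (I : R -> Prop) : Prop :=
  [/\ I 0,
      forall x y, I x -> I y -> I (x - y),
      forall a x, I x -> I (a * x) /\ I (x * a) &
      forall (s : seq Gamma) (f : Gamma -> R), uniq s ->
        (forall sigma, sigma \in s -> grcomp sigma (f sigma)) ->
        I (\sum_(sigma <- s) f sigma) ->
        forall sigma, sigma \in s -> I (f sigma)].

Definition gr_simple R : Prop :=
  forall I : R -> Prop, graded_ideal I ->
    (forall x, I x -> x = 0) \/ (forall x, I x).

Definition gr_prime R : Prop :=
  forall x y : R, homogeneous x -> homogeneous y ->
    (forall a : R, x * a * y = 0) -> x = 0 \/ y = 0.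

Definition gr_iso A B : Prop :=
  exists f : {rmorphism A -> B}, bijective f /\
    forall (sigma : Gamma) (x : A), grcomp sigma x <-> grcomp sigma (f x).

Lemma grcompN R sigma (x : R) : grcomp sigma x -> grcomp sigma (- x).
Proof. by move=> hx; rewrite -sub0r; apply: grcompB => //; apply: grcomp0. Qed.

Lemma grcompD R sigma (x y : R) :
  grcomp sigma x -> grcomp sigma y -> grcomp sigma (x + y).
Proof. by move=> hx hy; rewrite -[y]opprK; apply: grcompB => //; apply: grcompN. Qed.

Lemma grcomp_sum R sigma (I : eqType) (s : seq I) (F : I -> R) :
  (forall i, i \in s -> grcomp sigma (F i)) -> grcomp sigma (\sum_(i <- s) F i).
Proof.
move=> h; rewrite big_seq; apply: (big_ind (grcomp sigma)) => //.
- exact: grcomp0.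
- by move=> x y; apply: grcompD.
Qed.

End GradedNotions.
Arguments centralizes_grsupp {Gamma} R gamma.

(* M_oo(A): an element is the finitely supported family of its entries. *)
Section InfiniteMatrices.
Variables (Gamma : groupType).

Definition minf (A : grRingType Gamma) := {malg A[(nat * nat)%type]}.
HB.instance Definition _ A := GRing.Zmodule.on (minf A).

Definition minf_mul A (X Y : minf A) : minf A :=
  \sum_(p <- msupp X) \sum_(q <- msupp Y | p.2 == q.1)
    << X@_p * Y@_q *g (p.1, q.2) >>.

Definition minf_comp A (sigma : Gamma) (X : minf A) : Prop :=
  forall i j, grcomp sigma X@_(i, j).

Lemma minf_mulE A (X Y : minf A) (n i k : nat) :
  (forall i' j, (n <= j)%N -> X@_(i', j) = 0) ->
  (minf_mul X Y)@_(i, k) = \sum_(j < n) X@_(i, val j) * Y@_(val j, k).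
Proof.
move=> hn; rewrite /minf_mul raddf_sum /=.
transitivity (\sum_(p <- msupp X | p.1 == i) X@_p * Y@_(p.2, k)).
  rewrite [RHS]big_mkcond /=; apply: eq_bigr => -[a b] _ /=.
  rewrite raddf_sum /= big_mkcond /=.
  transitivity (\sum_(q <- msupp Y) if q == (b, k)
      then (if a == i then X@_(a, b) * Y@_(b, k) else 0) else 0).
    apply: eq_bigr => -[c d] _ /=; rewrite xpair_eqE [c == b]eq_sym.
    case: eqP => //= <-; rewrite mcoeffU xpair_eqE.
    by case: (a == i); case: eqP => [->|] //=; rewrite ?mulr1n.
  case: (boolP ((b, k) \in msupp Y)) => [hY|/mcoeff_outdom hY].
    rewrite (big_fsetD1 _ hY) /= eqxx big_seq big1 ?addr0 // => q.
    by rewrite in_fsetD1 => /andP[/negbTE ->].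
  by rewrite hY mulr0 if_same big1 // => q _; rewrite if_same.
transitivity (\sum_(p <- msupp X)
    \sum_(j < n) if p == (i, val j) then X@_(i, val j) * Y@_(val j, k) else 0).
  rewrite big_mkcond /= big_seq [RHS]big_seq; apply: eq_bigr => -[a b] hp /=.
  have hb : (b < n)%N.
    by rewrite ltnNge; apply: contraL hp => /hn h; rewrite -mcoeff_eq0 h.
  rewrite (bigD1 (Ordinal hb)) //= big1 ?addr0.
    by rewrite xpair_eqE eqxx andbT; case: eqP => [->|].
  move=> j; rewrite xpair_eqE -val_eqE /= [b == j]eq_sym => /negbTE ->.
  by rewrite andbF.
rewrite exchange_big; apply: eq_bigr => j _ /=.
case: (boolP ((i, val j) \in msupp X)) => [hX|/mcoeff_outdom hX].
  rewrite (big_fsetD1 _ hX) /= eqxx big_seq big1 ?addr0 // => q.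
  by rewrite in_fsetD1 => /andP[/negbTE ->].
by rewrite hX mul0r big1 // => q _; rewrite if_same.
Qed.

Definition gr_stably_iso (A B : grRingType Gamma) : Prop :=
  exists f : {additive minf A -> minf B},
    [/\ bijective f,
        forall X Y, f (minf_mul X Y) = minf_mul (f X) (f Y) &
        forall (sigma : Gamma) X, minf_comp sigma X <-> minf_comp sigma (f X)].

End InfiniteMatrices.

Record gridem (Gamma : groupType) (R : grRingType Gamma) := GrIdem {
  gridem_val :> R;
  gridemK : gridem_val * gridem_val = gridem_val;
  gridem_deg : grcomp (1%g : Gamma) gridem_val
}.

Definition full_gridem (Gamma : groupType) (R : grRingType Gamma)
    (l : gridem R) : Prop :=
  forall x : R, grcomp (1%g : Gamma) x <->
    exists s : seq (R * R),
      (forall p, p \in s ->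
         grcomp (1%g : Gamma) p.1 /\ grcomp (1%g : Gamma) p.2) /\
      x = \sum_(p <- s) p.1 * (l : R) * p.2.

Section Corner.
Variables (Gamma : groupType) (R : grRingType Gamma) (e : gridem R).
Local Notation l := (gridem_val e).

Definition in_corner : {pred R} := fun x => l * x * l == x.

Lemma in_cornerP x : reflect (exists y, x = l * y * l) (x \in in_corner).
Proof.
apply: (iffP eqP) => [<-|[y ->]]; first by exists x.
by rewrite !mulrA gridemK -mulrA gridemK.
Qed.

Fact in_corner_zmod : zmod_closed in_corner.
Proof.
split=> [|x y]; rewrite !unfold_in ?mulr0 ?mul0r // => /eqP hx /eqP hy.
by rewrite mulrBr mulrBl hx hy.
Qed.
HB.instance Definition _ := GRing.isZmodClosed.Build R in_corner in_corner_zmod.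

Record corner := Corner { corner_val :> R; _ : corner_val \in in_corner }.
HB.instance Definition _ := [isSub for corner_val].
HB.instance Definition _ := [Choice of corner by <:].
HB.instance Definition _ := [SubChoice_isSubZmodule of corner by <:].

Implicit Types x y z : corner.

Lemma corner_sand x : l * val x * l = val x.
Proof. exact/eqP/(valP x). Qed.

Lemma corner_mull x : l * val x = val x.
Proof. by rewrite -corner_sand !mulrA gridemK. Qed.

Lemma corner_mulr x : val x * l = val x.
Proof. by rewrite -corner_sand -!mulrA gridemK. Qed.

Fact sand_subproof (a : R) : l * a * l \in in_corner.
Proof. by apply/in_cornerP; exists a. Qed.
Definition corner_proj (a : R) : corner := Corner (sand_subproof a).

Fact corner_one_subproof : (l : R) \in in_corner.
Proof. by rewrite unfold_in !gridemK. Qed.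
Definition corner_one : corner := Corner corner_one_subproof.

Fact corner_mul_subproof x y : val x * val y \in in_corner.
Proof. by rewrite unfold_in mulrA corner_mull -mulrA corner_mulr. Qed.
Definition corner_mul x y : corner := Corner (corner_mul_subproof x y).

Fact corner_mulA : associative corner_mul.
Proof. by move=> x y z; apply: val_inj; rewrite /= mulrA. Qed.
Fact corner_mul1 : left_id corner_one corner_mul.
Proof. by move=> x; apply: val_inj; rewrite /= corner_mull. Qed.
Fact corner_1mul : right_id corner_one corner_mul.
Proof. by move=> x; apply: val_inj; rewrite /= corner_mulr. Qed.
Fact corner_mulDl : left_distributive corner_mul +%R.
Proof. by move=> x y z; apply: val_inj; rewrite /= mulrDl. Qed.
Fact corner_mulDr : right_distributive corner_mul +%R.
Proof. by move=> x y z; apply: val_inj; rewrite /= mulrDr. Qed.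

HB.instance Definition _ := GRing.Zmodule_isPzRing.Build corner
  corner_mulA corner_mul1 corner_1mul corner_mulDl corner_mulDr.

Definition corner_comp (sigma : Gamma) x : Prop :=
  exists2 y : R, grcomp sigma y & val x = l * y * l.

Lemma corner_compE sigma x : corner_comp sigma x <-> grcomp sigma (val x).
Proof.
split=> [[y hy ->]|hx]; last by exists (val x); rewrite ?corner_sand.
rewrite -[sigma]mul1g -[(1 * sigma)%g]mulg1.
by do 2?[apply: grcompM]; rewrite ?mul1g //; apply: gridem_deg.
Qed.

Fact corner_comp0 sigma : corner_comp sigma 0.
Proof. by apply/corner_compE; apply: grcomp0. Qed.
Fact corner_compB sigma x y :
  corner_comp sigma x -> corner_comp sigma y -> corner_comp sigma (x - y).
Proof. by rewrite !corner_compE; apply: grcompB. Qed.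
Fact corner_compM sigma tau x y : corner_comp sigma x -> corner_comp tau y ->
  corner_comp (sigma * tau)%g (x * y).
Proof. by rewrite !corner_compE; apply: grcompM. Qed.
Fact corner_comp1 : corner_comp 1%g 1.
Proof. by apply/corner_compE; apply: gridem_deg. Qed.
Fact corner_span x : exists s : seq (Gamma * corner),
  (forall p, p \in s -> corner_comp p.1 p.2) /\ x = \sum_(p <- s) p.2.
Proof.
have [s [hs xE]] := grcomp_span (val x : R).
exists [seq (p.1, corner_proj p.2) | p <- s]; split.
  by move=> _ /mapP[p ps ->]; exists p.2 => //; apply: hs.
apply: val_inj; rewrite big_map raddf_sum /= -mulr_suml -mulr_sumr -xE.
by rewrite corner_sand.
Qed.
Fact corner_indep (s : seq Gamma) (f : Gamma -> corner) : uniq s ->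
  (forall sigma, sigma \in s -> corner_comp sigma (f sigma)) ->
  \sum_(sigma <- s) f sigma = 0 -> forall sigma, sigma \in s -> f sigma = 0.
Proof.
move=> us hf /(congr1 val); rewrite raddf_sum /= => h sigma hs.
apply: val_inj; apply: (@grcomp_indep _ R s (fun t => val (f t)) us) hs => //.
by move=> t ht; apply/corner_compE/hf.
Qed.

HB.instance Definition _ := isGraded.Build Gamma corner corner_comp0
  corner_compB corner_compM corner_comp1 corner_span corner_indep.

Lemma corner_centralizes gamma :
  centralizes_grsupp R gamma -> centralizes_grsupp corner gamma.
Proof.
move=> h sigma [x /corner_compE hx x0]; apply: h; exists (val x) => // x0'.
by apply: x0; apply: val_inj.
Qed.

End Corner.
Arguments corner_centralizes {Gamma R} e {gamma}.

Record grder (Gamma : groupType) (R : grRingType Gamma) (gamma : Gamma) :=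
  GrDer {
    grder_fun :> {additive R -> R};
    grderM : forall x y, grder_fun (x * y) = grder_fun x * y + x * grder_fun y;
    grder_deg : forall tau, grsupp R tau -> forall x,
      grcomp tau x -> grcomp (tau * gamma)%g (grder_fun x)
  }.

Section CornerDerivation.
Variables (Gamma : groupType) (R : grRingType Gamma) (gamma : Gamma).
Variables (l : gridem R) (delta : grder R gamma).

Definition corner_der_fun (s : corner l) : corner l :=
  corner_proj l (delta (val s)).

Fact corner_der_additive : zmod_morphism corner_der_fun.
Proof. by move=> x y; apply: val_inj; rewrite /= raddfB mulrBr mulrBl. Qed.
HB.instance Definition _ :=
  GRing.isZmodMorphism.Build _ _ corner_der_fun corner_der_additive.

Fact corner_derM x y :
  corner_der_fun (x * y) = corner_der_fun x * y + x * corner_der_fun y.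
Proof.
apply: val_inj; rewrite /= grderM mulrDr mulrDl; congr (_ + _).
  by rewrite -!mulrA corner_mulr corner_mull.
by rewrite !mulrA corner_mull corner_mulr.
Qed.

Fact corner_der_deg tau : grsupp (corner l) tau -> forall x : corner l,
  grcomp tau x -> grcomp (tau * gamma)%g (corner_der_fun x).
Proof.
move=> [y /corner_compE hy y0] x /corner_compE hx.
exists (delta (val x)) => //; apply: grder_deg hx; exists (val y) => // y0'.
by apply: y0; apply: val_inj.
Qed.

(* s |-> l delta(s) l.  This is a derivation of lRl whether or not
   delta(l) = 0. *)
Definition corner_der : grder (corner l) gamma :=
  @GrDer _ _ _ corner_der_fun corner_derM corner_der_deg.

End CornerDerivation.

(* R[t; delta]: p : ore stands for \sum_k p@_k t^k, coefficients on the left.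
   The proof that gamma centralizes the support is an argument because the
   grading is defined only under this hypothesis. *)
Section Ore.
Variables (Gamma : groupType) (R : grRingType Gamma) (gamma : Gamma).
Variables (hgamma : centralizes_grsupp R gamma) (delta : grder R gamma).

Definition ore of centralizes_grsupp R gamma & grder R gamma :=
  {malg R[nat]}.
Local Notation S := (ore hgamma delta).
HB.instance Definition _ := GRing.Zmodule.on S.

Implicit Types p q r : S.

Definition ore_scale (c : R) (p : S) : S :=
  \sum_(k <- msupp p) << c * p@_k *g k >>.

(* Left multiplication by t: t * (x t^k) = x t^k.+1 + delta(x) t^k. *)
Definition ore_tmul (p : S) : S :=
  \sum_(k <- msupp p) (<< p@_k *g k.+1 >> + << delta p@_k *g k >>).

Definition ore_mul (p q : S) : S :=
  \sum_(i <- msupp p) ore_scale p@_i (iter i ore_tmul q).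

Definition oreC (x : R) : S := << x *g 0%N >>.
Definition oret : S := << 1 *g 1%N >>.

Lemma oreP p q : (forall k, p@_k = q@_k) -> p = q.
Proof. by move/malgP. Qed.

Lemma coef_oreD p q k : (p + q : S)@_k = p@_k + q@_k.
Proof. exact: mcoeffD. Qed.

Lemma coef_ore_sum (I : Type) (s : seq I) (F : I -> S) k :
  (\sum_(i <- s) F i)@_k = \sum_(i <- s) (F i)@_k.
Proof.
elim: s => [|i s IH]; first by rewrite !big_nil; apply: mcoeff0.
by rewrite !big_cons coef_oreD IH.
Qed.

Lemma ore_sumw (F : nat -> R -> S) p (d : {fset nat}) :
  (forall i, F i 0 = 0) -> (msupp p `<=` d)%fset ->
  \sum_(i <- msupp p) F i p@_i = \sum_(i <- d) F i p@_i.
Proof.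
move=> F0 le; apply: big_fset_incl => // k _ /mcoeff_outdom ->; exact: F0.
Qed.

Lemma ore_scaleE c p k : (ore_scale c p)@_k = c * p@_k.
Proof.
rewrite coef_ore_sum; under eq_bigr do rewrite mcoeffU.
case: (boolP (k \in msupp p)) => [kp|knp].
  rewrite (big_fsetD1 k) //= eqxx mulr1n big_seq big1 ?addr0 // => i.
  by rewrite in_fsetD1 => /andP[/negbTE ->].
rewrite (mcoeff_outdom knp) mulr0 big_seq big1 // => i ip.
by case: eqP => // e; rewrite -e ip in knp.
Qed.

Lemma ore_tmulE p k :
  (ore_tmul p)@_k = (if k is k'.+1 then p@_k' else 0) + delta p@_k.
Proof.
rewrite /ore_tmul.
have aux (G : {additive R -> R}) j :
    \sum_(i <- msupp p) G p@_i *+ (i == j) = G p@_j.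
  case: (boolP (j \in msupp p)) => [kp|knp].
    rewrite (big_fsetD1 j) //= eqxx mulr1n big_seq big1 ?addr0 // => i.
    by rewrite in_fsetD1 => /andP[/negbTE ->].
  rewrite (mcoeff_outdom knp) raddf0 big_seq big1 // => i ip.
  by case: eqP => // e; rewrite -e ip in knp.
rewrite coef_ore_sum.
under eq_bigr do rewrite mcoeffD !mcoeffU.
rewrite big_split /= aux; congr (_ + _).
case: k => [|k]; first by rewrite big1.
under eq_bigr do rewrite eqSS.
exact: (aux idfun).
Qed.

Lemma ore_tmulD p q : ore_tmul (p + q) = ore_tmul p + ore_tmul q.
Proof.
apply: oreP => k; rewrite coef_oreD !ore_tmulE !coef_oreD raddfD addrACA.
by congr (_ + _); case: k => [|k]; rewrite ?addr0 // coef_oreD.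
Qed.

Lemma ore_tmulZ c p :
  ore_tmul (ore_scale c p) = ore_scale c (ore_tmul p) + ore_scale (delta c) p.
Proof.
apply: oreP => k; rewrite coef_oreD !(ore_tmulE, ore_scaleE) grderM mulrDr.
rewrite [delta c * _ + _]addrC addrA; congr (_ + _ + _).
by case: k => [|k]; rewrite ?mulr0 // ore_scaleE.
Qed.

Lemma ore_tmul0 : ore_tmul 0 = 0.
Proof. by apply: (addrI (ore_tmul 0)); rewrite -ore_tmulD !addr0. Qed.

Lemma iter_tmulD i p q :
  iter i ore_tmul (p + q) = iter i ore_tmul p + iter i ore_tmul q.
Proof. by elim: i => //= i ->; rewrite ore_tmulD. Qed.

Lemma iter_tmul0 i : iter i ore_tmul 0 = 0.
Proof. by elim: i => //= i ->; rewrite ore_tmul0. Qed.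

Lemma ore_scaleD c p q : ore_scale c (p + q) = ore_scale c p + ore_scale c q.
Proof.
by apply: oreP => k; rewrite coef_oreD !ore_scaleE coef_oreD mulrDr.
Qed.

Lemma ore_scale0 c : ore_scale c 0 = 0.
Proof. by apply: (addrI (ore_scale c 0)); rewrite -ore_scaleD !addr0. Qed.

Lemma ore_scaleDl c d p : ore_scale (c + d) p = ore_scale c p + ore_scale d p.
Proof. by apply: oreP => k; rewrite coef_oreD !ore_scaleE mulrDl. Qed.

Lemma ore_0scale p : ore_scale 0 p = 0.
Proof. by apply: (addrI (ore_scale 0 p)); rewrite -ore_scaleDl !addr0. Qed.

Lemma ore_scaleA c d p : ore_scale c (ore_scale d p) = ore_scale (c * d) p.
Proof. by apply: oreP => k; rewrite !ore_scaleE mulrA. Qed.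

Lemma ore_scale1 p : ore_scale 1 p = p.
Proof. by apply: oreP => k; rewrite !ore_scaleE mul1r. Qed.

Lemma ore_mulw p q (d : {fset nat}) : (msupp p `<=` d)%fset ->
  ore_mul p q = \sum_(i <- d) ore_scale p@_i (iter i ore_tmul q).
Proof.
by move=> h; apply: (ore_sumw (F := fun i c => ore_scale c _)) => // i;
  rewrite ore_0scale.
Qed.

Lemma ore_mulDl : left_distributive ore_mul +%R.
Proof.
move=> p q r.
rewrite (ore_mulw _ (msuppD_le p q)) (ore_mulw _ (fsubsetUl _ (msupp q))).
rewrite (ore_mulw _ (fsubsetUr (msupp p) _)) -big_split /=.
by apply: eq_bigr => i _; rewrite coef_oreD ore_scaleDl.
Qed.

Lemma ore_mulDr : right_distributive ore_mul +%R.
Proof.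
move=> p q r; rewrite /ore_mul -big_split /=; apply: eq_bigr => i _.
by rewrite iter_tmulD ore_scaleD.
Qed.

Lemma ore_mulU c k q :
  ore_mul << c *g k >> q = ore_scale c (iter k ore_tmul q).
Proof.
by rewrite (ore_mulw _ (msuppU_le)) big_seq_fset1 mcoeffUU.
Qed.

Lemma ore_mul0l q : ore_mul 0 q = 0.
Proof. by apply: (addrI (ore_mul 0 q)); rewrite -ore_mulDl !addr0. Qed.

Lemma ore_mul_suml (I : Type) (s : seq I) (F : I -> S) q :
  ore_mul (\sum_(i <- s) F i) q = \sum_(i <- s) ore_mul (F i) q.
Proof.
elim: s => [|i s IH]; first by rewrite !big_nil ore_mul0l.
by rewrite !big_cons ore_mulDl IH.
Qed.

Lemma ore_tmul_sum (I : Type) (s : seq I) (F : I -> S) :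
  ore_tmul (\sum_(i <- s) F i) = \sum_(i <- s) ore_tmul (F i).
Proof.
elim: s => [|i s IH]; first by rewrite !big_nil ore_tmul0.
by rewrite !big_cons ore_tmulD IH.
Qed.

Lemma ore_scale_sum c (I : Type) (s : seq I) (F : I -> S) :
  ore_scale c (\sum_(i <- s) F i) = \sum_(i <- s) ore_scale c (F i).
Proof.
elim: s => [|i s IH]; first by rewrite !big_nil ore_scale0.
by rewrite !big_cons ore_scaleD IH.
Qed.

Lemma oreE p : p = \sum_(k <- msupp p) << p@_k *g k >>.
Proof. exact: monalgE. Qed.

Lemma ore_scaleU c d k : ore_scale c << d *g k >> = << c * d *g k >>.
Proof. by apply: oreP => j; rewrite ore_scaleE !mcoeffU mulrnAr. Qed.

Lemma ore_mul_scale c q r :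
  ore_mul (ore_scale c q) r = ore_scale c (ore_mul q r).
Proof.
rewrite {1}[q]oreE ore_scale_sum ore_mul_suml [ore_mul q r]/ore_mul ore_scale_sum.
apply: eq_bigr => i _.
by rewrite ore_scaleU ore_mulU ore_scaleA.
Qed.

Lemma ore_mul_tmul q r : ore_mul (ore_tmul q) r = ore_tmul (ore_mul q r).
Proof.
rewrite {1}/ore_tmul ore_mul_suml ore_tmul_sum; apply: eq_bigr => i _.
by rewrite ore_mulDl !ore_mulU ore_tmulZ.
Qed.

Lemma ore_mulA : associative ore_mul.
Proof.
move=> p q r; rewrite [ore_mul p q]/ore_mul ore_mul_suml [LHS]/ore_mul.
apply: eq_bigr => i _; rewrite ore_mul_scale; congr ore_scale.
by elim: i => //= i IH; rewrite ore_mul_tmul IH.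
Qed.

Lemma ore_mul1l : left_id (oreC 1) ore_mul.
Proof. by move=> p; rewrite ore_mulU ore_scale1. Qed.

Lemma ore_mul1r : right_id (oreC 1) ore_mul.
Proof.
have d1 : delta 1 = 0.
  by apply: (addrI (delta 1)); rewrite addr0 -{3}[1]mulr1 grderM mulr1 mul1r.
have tE i : iter i ore_tmul (oreC 1) = << 1 *g i >>.
  elim: i => //= i ->; apply: oreP => k; rewrite ore_tmulE !mcoeffU.
  rewrite raddfMn /= d1 mul0rn addr0.
  by case: k => [|k]; rewrite ?mcoeffU ?eqSS.
move=> p; rewrite /ore_mul [RHS]oreE; apply: eq_bigr => i _.
by rewrite tE ore_scaleU mulr1.
Qed.

HB.instance Definition _ := GRing.Zmodule_isPzRing.Build S
  ore_mulA ore_mul1l ore_mul1r ore_mulDl ore_mulDr.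

Lemma ore_mulE p q : p * q = ore_mul p q.
Proof. by []. Qed.

Lemma oreC_rmorph : zmod_morphism oreC /\ monoid_morphism oreC.
Proof.
split; first by move=> x y; apply: monalgUB.
by split=> // x y; rewrite ore_mulE /oreC ore_mulU /= ore_scaleU.
Qed.
HB.instance Definition _ := GRing.isZmodMorphism.Build R S oreC oreC_rmorph.1.
HB.instance Definition _ := GRing.isMonoidMorphism.Build R S oreC oreC_rmorph.2.

Lemma oret_comm (x : R) : oret * oreC x = oreC x * oret + oreC (delta x).
Proof.
rewrite !ore_mulE /oret /oreC !ore_mulU ore_scale1 /= ore_scaleU mulr1.
apply: oreP => k; rewrite ore_tmulE coef_oreD !mcoeffU raddfMn.
by case: k => [|k]; rewrite ?mcoeffU ?eqSS.
Qed.

Lemma oret_exp k : oret ^+ k = << 1 *g k >> :> S.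
Proof.
elim: k => // k IH; rewrite exprSr IH ore_mulE ore_mulU ore_scale1 /oret.
elim: k {IH} => // k IH; rewrite iterS IH; apply: oreP => j.
rewrite ore_tmulE !mcoeffU raddfMn.
have -> : delta 1 = 0.
  by apply: (addrI (delta 1)); rewrite addr0 -{3}[1]mulr1 grderM mulr1 mul1r.
by rewrite mul0rn addr0; case: j => [|j]; rewrite ?mcoeffU ?eqSS.
Qed.

Lemma ore_expand p : p = \sum_(k <- msupp p) oreC p@_k * oret ^+ k.
Proof.
rewrite {1}[p]oreE; apply: eq_bigr => k _.
by rewrite oret_exp ore_mulE /oreC ore_mulU /= ore_scaleU mulr1.
Qed.

Definition ore_comp (tau : Gamma) (p : S) : Prop :=
  forall i, grcomp (tau * gamma ^- i)%g p@_i.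

Fact ore_comp0 sigma : ore_comp sigma 0.
Proof. by move=> i; rewrite mcoeff0; apply: grcomp0. Qed.

Fact ore_compB sigma p q :
  ore_comp sigma p -> ore_comp sigma q -> ore_comp sigma (p - q).
Proof. by move=> hp hq i; rewrite mcoeffB; apply: grcompB. Qed.

Lemma grder_comp tau (x : R) : grcomp tau x -> grcomp (tau * gamma)%g (delta x).
Proof.
move=> hx; case: (eqVneq x 0) => [->|/eqP x0].
  by rewrite raddf0; apply: grcomp0.
exact: (@grder_deg _ _ _ delta tau (ex_intro2 _ _ x hx x0) x hx).
Qed.

Lemma ore_comp_tmul tau p : ore_comp tau p -> ore_comp (tau * gamma)%g (ore_tmul p).
Proof.
move=> hp i; rewrite ore_tmulE; apply: grcompD; last first.
  have -> : (tau * gamma * gamma ^- i = tau * gamma ^- i * gamma)%g.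
    rewrite -!mulgA; congr (_ * _)%g.
    exact/commuteV/commuteX/commute_refl.
  exact: grder_comp.
case: i => [|i]; first exact: grcomp0.
by rewrite expgSr mulgKA.
Qed.

Fact ore_compM sigma tau p q : ore_comp sigma p -> ore_comp tau q ->
  ore_comp (sigma * tau)%g (p * q).
Proof.
move=> hp hq; case: (eqVneq (q : S) 0) => [->|].
  by rewrite mulr0; apply: ore_comp0.
move=> q0; have [j qj] : exists j, q@_j <> 0.
  case: (fset_0Vmem (msupp q)) => [e|[j]].
    by case/eqP: q0; apply: oreP => k; rewrite mcoeff0 mcoeff_outdom // e.
  by rewrite -mcoeff_neq0 => /eqP; exists j.
have ct : commute gamma tau.
  have c : commute gamma (tau * gamma ^- j)%g by apply: hgamma; exists q@_j.
  rewrite -[tau](mulgVK (gamma ^+ j)%g); apply: commuteM c _.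
  exact/commuteX/commute_refl.
move=> k; rewrite ore_mulE coef_ore_sum.
apply: grcomp_sum => i _; rewrite ore_scaleE.
have -> : (sigma * tau * gamma ^- k =
    (sigma * gamma ^- i) * (tau * gamma ^+ i * gamma ^- k))%g.
  rewrite -!mulgA; congr (_ * _)%g; rewrite !mulgA; congr (_ * _)%g.
  have /commute_sym c := commuteX i (commute_sym ct).
  by rewrite -mulgA -c mulKg.
apply: grcompM; first exact: hp.
suff h : ore_comp (tau * gamma ^+ i)%g (iter i ore_tmul q) by apply: h.
elim: i => [|i IH]; first by rewrite mulg1.
by rewrite expgSr mulgA; apply: ore_comp_tmul.
Qed.

Lemma ore_compU sigma x k : grcomp sigma x ->
  ore_comp (sigma * gamma ^+ k)%g << x *g k >>.
Proof.
move=> hx i; rewrite mcoeffU; case: eqP => [<-|_]; first by rewrite mulgK.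
exact: grcomp0.
Qed.

Fact ore_comp1 : ore_comp 1%g 1.
Proof. by have := ore_compU 0 (grcomp1 (s := R)); rewrite mulg1. Qed.

Fact ore_span p : exists s : seq (Gamma * S),
  (forall c, c \in s -> ore_comp c.1 c.2) /\ p = \sum_(c <- s) c.2.
Proof.
rewrite [p]oreE; elim: (enum_fset (msupp p)) => [|k ks [s [hs IH]]].
  by exists [::]; split=> //; rewrite !big_nil.
have [r [hr xE]] := grcomp_span (p@_k : R).
exists ([seq ((c.1 * gamma ^+ k)%g, << c.2 *g k >>) | c <- r] ++ s); split.
  move=> c; rewrite mem_cat => /orP[/mapP[d dr ->]|/hs //].
  by apply: ore_compU; apply: hr.
rewrite big_cons big_cat big_map IH /= {1}xE; congr (_ + _).
exact: raddf_sum.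
Qed.

Fact ore_indep (s : seq Gamma) (f : Gamma -> S) : uniq s ->
  (forall sigma, sigma \in s -> ore_comp sigma (f sigma)) ->
  \sum_(sigma <- s) f sigma = 0 -> forall sigma, sigma \in s -> f sigma = 0.
Proof.
move=> us hf h sigma hs; apply: oreP => k; rewrite mcoeff0.
pose g (tau : Gamma) := (f (tau * gamma ^+ k)%g)@_k.
have -> : (f sigma)@_k = g (sigma * gamma ^- k)%g by rewrite /g mulgVK.
have inj : injective (fun t : Gamma => t * gamma ^- k)%g := @mulIg _ _.
apply: (@grcomp_indep _ _ [seq (t * gamma ^- k)%g | t <- s]).
- by rewrite (map_inj_uniq inj).
- by move=> _ /mapP[t ts ->]; rewrite /g mulgVK; apply: hf.
- rewrite big_map /g; under eq_bigr do rewrite mulgVK.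
  by rewrite -coef_ore_sum h mcoeff0.
- exact: map_f.
Qed.

HB.instance Definition _ := isGraded.Build Gamma S ore_comp0
  ore_compB ore_compM ore_comp1 ore_span ore_indep.

Fact oreC_idem (l : gridem R) : oreC l * oreC l = oreC l.
Proof. by rewrite -rmorphM gridemK. Qed.
Fact oreC_deg (l : gridem R) : grcomp (1%g : Gamma) (oreC l).
Proof. by have := ore_compU 0 (gridem_deg l); rewrite mulg1. Qed.
Definition ore_gridem (l : gridem R) : gridem S :=
  GrIdem (oreC_idem l) (oreC_deg l).

End Ore.

(* Main.v *)
Require Import Defs.
From mathcomp Require Import all_boot all_order all_algebra.
From HB Require Import structures.
From mathcomp Require Import finmap.
From mathcomp.multinomials Require Import monalg.
Local Open Scope ring_scope.
Import GRing.Theory.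

Set Implicit Arguments.
Unset Strict Implicit.
Unset Printing Implicit Defensive.

(** Stable invariance is Morita theory carried out with matrix units. Write [S]
    for the differential polynomial ring [R[t; delta]]. Although [A] and [S] need not be isomorphic,
    entries of matrices are reached inside the matrix rings: multiplying [X] by
    [E_0i] on the left and by [E_j0] on the right leaves the single entry
    [X_ij] ([munit_sandwich]), and the entries of [X (b E_jk) Y] are the products
    [X_ij b Y_kl] ([minf_mul_munit_mul]). Both properties therefore translate
    into properties of the infinite matrix ring, which the given isomorphism
    transports. For gr-simplicity, a graded ideal [I] of one ring is sent to the
    graded ideal of those [a] in the other for which the image of [a E_00] has
    all its entries in [I]; this ideal being zero or everything forces the same
    of [I] ([gr_stably_iso_simple]). For gr-primeness, homogeneous [x], [y] with
    [x A y = 0] give matrices with [(x E_00) Z (y E_00) = 0] for every [Z], and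
    any two nonzero entries of their images would contradict gr-primeness
    ([gr_stably_iso_prime]). Here the entries of the image of [x E_00] all have
    the degree of [x], since the isomorphism preserves degrees entrywise. Stable
    isomorphism being symmetric, one implication suffices for each property.

    The description of corners rests on the fact that, as [delta l = 0], the
    idempotent [l] commutes with [t]. Hence [l (sum_k p_k t^k) l = sum_k (l p_k l) t^k] ([ore_sandE]): the
    corner of [S] at [l] consists of the polynomials with coefficients in
    [l R l]. Reading such a polynomial as an element of the differential
    polynomial ring over [l R l] is multiplicative because [delta] already maps
    [l R l] to itself, so that the induced derivation is a mere restriction
    ([corner_derE]). *)

(** * Graded isomorphisms *)

Section GradedIso.
Variable Gamma : groupType.
Implicit Types A B C : grRingType Gamma.

Lemma gr_iso_sym A B : gr_iso A B -> gr_iso B A.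
Proof.
move=> [f [[g fK gK] fdeg]].
pose gZ := GRing.isZmodMorphism.Build _ _ g (can2_zmod_morphism fK gK).
pose gM := GRing.isMonoidMorphism.Build _ _ g (can2_monoid_morphism fK gK).
pose g' : {rmorphism B -> A} := HB.pack g gZ gM.
exists g'; split; first by exists f.
by move=> sigma y; rewrite fdeg /= gK.
Qed.

Lemma gr_iso_trans A B C : gr_iso A B -> gr_iso B C -> gr_iso A C.
Proof.
move=> [f [fbij fdeg]] [g [gbij gdeg]].
exists (g \o f : {rmorphism A -> C}); split; first exact: bij_comp.
by move=> sigma x; rewrite fdeg gdeg.
Qed.

(** Stable isomorphism in a form that shows its symmetry: the inverse bijection
    is again additive, multiplicative and degree-preserving. *)
Lemma gr_stably_iso_inv A B : gr_stably_iso A B ->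
  exists (f : {additive minf A -> minf B}) (g : {additive minf B -> minf A}),
    [/\ cancel f g /\ cancel g f,
        (forall X Y, f (minf_mul X Y) = minf_mul (f X) (f Y)) /\
        (forall X Y, g (minf_mul X Y) = minf_mul (g X) (g Y)) &
        (forall sigma X, minf_comp sigma X <-> minf_comp sigma (f X)) /\
        (forall sigma Y, minf_comp sigma Y <-> minf_comp sigma (g Y))].
Proof.
move=> [f [[g fK gK] fM fdeg]].
pose gZ := GRing.isZmodMorphism.Build _ _ g (can2_zmod_morphism fK gK).
pose g' : {additive minf B -> minf A} := HB.pack g gZ.
exists f, g'; do !split=> //.
- by move=> X Y; apply: (can_inj fK); rewrite fM /= !gK.
- by move=> hY; apply/fdeg; rewrite /= gK.
- by move=> /fdeg; rewrite /= gK.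
Qed.

Lemma gr_stably_iso_sym A B : gr_stably_iso A B -> gr_stably_iso B A.
Proof.
move=> /gr_stably_iso_inv [f [g [[fK gK] [_ gM] [_ gdeg]]]].
by exists g; split=> //; exists f.
Qed.

End GradedIso.

(** * Matrix units in the ring of finite infinite matrices *)

Section MatrixUnits.
Variables (Gamma : groupType) (A : grRingType Gamma).
Implicit Types (a b : A) (X Y : minf A) (i j k l : nat).

Definition munit a i j : minf A := << a *g (i, j) >>.

Lemma munitE a i j k l :
  (munit a i j)@_(k, l) = if (i == k) && (j == l) then a else 0.
Proof. by rewrite mcoeffU xpair_eqE; case: ifP. Qed.

Lemma minfP X Y : (forall i j, X@_(i, j) = Y@_(i, j)) -> X = Y.
Proof. by move=> h; apply/malgP => -[i j]. Qed.

Lemma minf_eq0_or X : X = 0 \/ exists i j, X@_(i, j) <> 0.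
Proof.
case: (fset_0Vmem (msupp X)) => [e|[[i j]]].
  by left; apply: minfP => i j; rewrite mcoeff0 mcoeff_outdom // e.
by rewrite -mcoeff_neq0 => /eqP h; right; exists i, j.
Qed.

Lemma minf_col_bound X : exists n, forall i j, (n <= j)%N -> X@_(i, j) = 0.
Proof.
exists (\max_(p <- msupp X) p.2).+1 => i j lt_j.
apply: mcoeff_outdom; apply: contraL lt_j => ij; rewrite -leqNgt.
exact: (@leq_bigmax_seq _ _ xpredT (fun p : nat * nat => p.2) (i, j)).
Qed.

Lemma minf_mul_col X Y i j k : (forall i' j', j' != j -> X@_(i', j') = 0) ->
  (minf_mul X Y)@_(i, k) = X@_(i, j) * Y@_(j, k).
Proof.
move=> hX; rewrite (@minf_mulE _ _ X Y j.+1); last first.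
  by move=> i' j' lt_j; apply: hX; rewrite gtn_eqF.
rewrite big_ord_recr /= big1 ?add0r // => m _.
by rewrite hX ?mul0r // ltn_eqF.
Qed.

Lemma minf_mulUl a i j Y k l :
  (minf_mul (munit a i j) Y)@_(k, l) = if i == k then a * Y@_(j, l) else 0.
Proof.
rewrite (@minf_mul_col _ _ k j); last first.
  by move=> i' j' ne; rewrite munitE [j == _]eq_sym (negbTE ne) andbF.
by rewrite munitE eqxx andbT; case: ifP; rewrite ?mul0r.
Qed.

Lemma minf_mulUr X b j k i l :
  (minf_mul X (munit b j k))@_(i, l) = if k == l then X@_(i, j) * b else 0.
Proof.
have [n hn] := minf_col_bound X.
rewrite (@minf_mulE _ _ X _ (maxn n j.+1)); last first.
  by move=> i' j'; rewrite geq_max => /andP[/hn->].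
have lt_j : (j < maxn n j.+1)%N by rewrite leq_max ltnSn orbT.
rewrite (bigD1 (Ordinal lt_j)) //= munitE eqxx big1 ?addr0.
  by case: (k == l); rewrite ?mulr0.
move=> m; rewrite -val_eqE /= => ne.
by rewrite munitE [j == _]eq_sym (negbTE ne) mulr0.
Qed.

Lemma minf_mulUU a b i j k :
  minf_mul (munit a i j) (munit b j k) = munit (a * b) i k.
Proof.
apply: minfP => m n; rewrite minf_mulUl !munitE eqxx /=.
by case: (i == m); case: (k == n); rewrite ?mulr0.
Qed.

(** This isolates an entry by multiplications alone, so it is preserved by any
    multiplicative map between matrix rings. *)
Lemma munit_sandwich X i j :
  minf_mul (minf_mul (munit 1 0 i) X) (munit 1 j 0) = munit X@_(i, j) 0 0.
Proof.
apply: minfP => m n; rewrite minf_mulUr minf_mulUl munitE.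
by case: (0 == m)%N; case: (0 == n)%N; rewrite ?mul0r ?mulr1 ?mul1r.
Qed.

(** The counterpart of [x b y] for matrices: a middle factor [b E_jk] couples
    column [j] of [X] to row [k] of [Y]. *)
Lemma minf_mul_munit_mul X b j k Y i l :
  (minf_mul (minf_mul X (munit b j k)) Y)@_(i, l) = X@_(i, j) * b * Y@_(k, l).
Proof.
rewrite (@minf_mul_col _ _ i k); last first.
  by move=> i' j' ne; rewrite minf_mulUr eq_sym (negbTE ne).
by rewrite minf_mulUr eqxx.
Qed.

Lemma munitB a b i j : munit (a - b) i j = munit a i j - munit b i j.
Proof. exact: monalgUB. Qed.

Lemma munit_sum (I : Type) (s : seq I) (F : I -> A) i j :
  munit (\sum_(c <- s) F c) i j = \sum_(c <- s) munit (F c) i j.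
Proof.
by elim/big_rec2: _ => [|c _ b _ <-]; [exact: monalgU0|exact: monalgUD].
Qed.

Lemma minf_comp_munit sigma a i j : grcomp sigma a -> minf_comp sigma (munit a i j).
Proof.
by move=> ha k l; rewrite munitE; case: ifP => // _; apply: grcomp0.
Qed.

End MatrixUnits.

(** * Graded stable invariance of gr-simplicity and gr-primeness *)

Section MatricesOverIdeal.
Variables (Gamma : groupType) (A : grRingType Gamma) (I : A -> Prop).
Hypothesis hI : graded_ideal I.

(** [M_oo(I)]. *)
Definition minf_over (X : minf A) : Prop := forall i j, I X@_(i, j).

Let I0 : I 0. Proof. by case: hI. Qed.
Let IB x y : I x -> I y -> I (x - y). Proof. by case: hI => _ h _ _; apply: h. Qed.
Let ID x y : I x -> I y -> I (x + y).
Proof. by move=> hx hy; rewrite -[y]opprK -[- y]sub0r; apply/IB/IB. Qed.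

Lemma minf_overU a i j : I a -> minf_over (munit a i j).
Proof. by move=> ha k l; rewrite munitE; case: ifP. Qed.

Lemma minf_overB X Y : minf_over X -> minf_over Y -> minf_over (X - Y).
Proof. by move=> hX hY i j; rewrite mcoeffB; apply: IB. Qed.

Lemma minf_overD X Y : minf_over X -> minf_over Y -> minf_over (X + Y).
Proof. by move=> hX hY i j; rewrite mcoeffD; apply: ID. Qed.

Lemma minf_over_mul X Y : minf_over X \/ minf_over Y -> minf_over (minf_mul X Y).
Proof.
have [n hn] := minf_col_bound X.
have [_ _ IM _] := hI.
move=> hXY i k; rewrite (minf_mulE Y i k hn); apply: (big_ind I) => // j _.
by case: hXY => h; [case: (IM Y@_(val j, k) _ (h i (val j)))
                   |case: (IM X@_(i, val j) _ (h (val j) k))].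
Qed.

End MatricesOverIdeal.

Section StableInvariance.
Variables (Gamma : groupType) (A B : grRingType Gamma).

(** A graded ideal [I] of [B] is compared with the ideal [J] of [A] formed by
    the [a] such that [f (a E_00)] has all its entries in [I]. If [J = 0], every
    [x] in [I] is [0], because [g (x E_00)] has its entries in [J]; if [J = A],
    matrix units move [a E_00] to any position, so that the image of [f], which
    is everything, has its entries in [I]. *)
Lemma gr_stably_iso_simple : gr_stably_iso A B -> gr_simple A -> gr_simple B.
Proof.
move=> /gr_stably_iso_inv [f [g [[fK gK] [fM _] [fdeg _]]]] simA I hI.
have [I0 _ _ Igr] := hI.
pose J (a : A) := minf_over I (f (munit a 0 0)).
have hJ : graded_ideal J.
  split.
  - have -> : J 0 = minf_over I 0 by rewrite /J /munit monalgU0 raddf0.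
    by move=> i j; rewrite mcoeff0.
  - by move=> x y hx hy; rewrite /J munitB raddfB; apply: minf_overB.
  - move=> a x hx; rewrite /J -!(minf_mulUU _ _ 0 0 0) !fM.
    by split; apply: minf_over_mul => //; [right|left].
  (* Each entry of [f (\sum_t F t E_00)] is the sum of the corresponding entries
     of the [f (F t E_00)], and these are its homogeneous components. *)
  move=> s F us hF hs sigma sin i j.
  apply: (Igr s (fun t => (f (munit (F t) 0 0))@_(i, j)) us) => // [t ts|].
    by have /fdeg := minf_comp_munit 0 0 (hF t ts); apply.
  suff -> : \sum_(t <- s) (f (munit (F t) 0 0))@_(i, j)
            = (f (munit (\sum_(t <- s) F t) 0 0))@_(i, j) by apply: hs.
  by rewrite munit_sum raddf_sum -(raddf_sum (mcoeff (i, j))).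
have [J0|JT] := simA J hJ; [left => x Ix | right => x].
  suff gx0 : g (munit x 0 0) = 0.
    have /(congr1 (mcoeff (0, 0)%N)) : munit x 0 0 = 0.
      by apply: (can_inj gK); rewrite gx0 raddf0.
    by rewrite mcoeff0 munitE.
  apply: minfP => i j; rewrite mcoeff0; apply: J0.
  rewrite /J -munit_sandwich !fM gK.
  apply: minf_over_mul => //; left; apply: minf_over_mul => //; right.
  exact: minf_overU.
have fI X : minf_over I (f X).
  rewrite [X]monalgE raddf_sum.
  apply: (big_ind (minf_over I)) => [i j| |[i j] _]; first by rewrite mcoeff0.
    exact: minf_overD.
  (* [X_ij E_ij = E_i0 (X_ij E_00) E_0j] *)
  rewrite -/(munit _ i j) -[X@_(i, j)]mul1r -(minf_mulUU _ _ i 0 j) fM.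
  apply: minf_over_mul => //; right.
  rewrite -[X@_(i, j)]mulr1 -(minf_mulUU _ _ 0 0 j) fM.
  by apply: minf_over_mul => //; left; apply: JT.
by have := fI (g (munit x 0 0)) 0 0; rewrite gK munitE.
Qed.

(** If [x B y = 0] then [(x E_00) Z (y E_00) = 0] for all [Z], hence also
    [g (x E_00) Z g (y E_00) = 0]; taking [Z = b E_jk] turns this into
    [X_ij b Y_kl = 0] for all entries [X_ij] and [Y_kl] of these two images. *)
Lemma gr_stably_iso_prime : gr_stably_iso A B -> gr_prime A -> gr_prime B.
Proof.
move=> /gr_stably_iso_inv [f [g [[fK gK] [_ gM] [_ gdeg]]]] primeA.
move=> x y [sx hx] [sy hy] xy0.
have gXZY Z : minf_mul (minf_mul (g (munit x 0 0)) Z) (g (munit y 0 0)) = 0.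
  rewrite -[Z]fK -!gM -[RHS](raddf0 g); congr (g _).
  apply: minfP => i j; rewrite minf_mulUr minf_mulUl mcoeff0.
  by case: ifP => // _; case: ifP => // _; rewrite ?xy0 ?mul0r.
have g0 z : g (munit z 0 0) = 0 -> z = 0.
  rewrite -(raddf0 g) => /(can_inj gK)/(congr1 (mcoeff (0, 0)%N)).
  by rewrite mcoeff0 munitE.
have ghom s z i j : grcomp s z -> homogeneous (g (munit z 0 0))@_(i, j).
  by move=> hz; exists s; have /gdeg := minf_comp_munit 0 0 hz; apply.
have [/g0|[i [j Xij]]] := minf_eq0_or (g (munit x 0 0)); first by left.
have [/g0|[k [l Ykl]]] := minf_eq0_or (g (munit y 0 0)); first by right.
case: (primeA _ _ (ghom _ _ i j hx) (ghom _ _ k l hy)) => // b.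
by rewrite -minf_mul_munit_mul gXZY mcoeff0.
Qed.

End StableInvariance.

(** * Corners of differential polynomial rings *)

Section MalgMap.
Variables (K : choiceType) (V W : zmodType) (g : V -> W).
Hypothesis g0 : g 0 = 0.

Definition malg_map (p : {malg V[K]}) : {malg W[K]} :=
  \sum_(k <- msupp p) << g p@_k *g k >>.

Lemma malg_mapE p k : (malg_map p)@_k = g p@_k.
Proof.
rewrite /malg_map raddf_sum /=; under eq_bigr do rewrite mcoeffU.
case: (boolP (k \in msupp p)) => [kp|knp].
  rewrite (big_fsetD1 k) //= eqxx mulr1n big_seq big1 ?addr0 // => i.
  by rewrite in_fsetD1 => /andP[/negbTE ->].
rewrite (mcoeff_outdom knp) g0 big_seq big1 // => i ip.
by case: eqP => // e; rewrite -e ip in knp.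
Qed.

(** The map [g] may kill coefficients, so the supports need not be equal; an
    inclusion lets sums over [msupp (malg_map p)] run over [msupp p]. *)
Lemma msupp_malg_map p : (msupp (malg_map p) `<=` msupp p)%fset.
Proof.
apply/fsubsetP => k; rewrite -!mcoeff_neq0 malg_mapE.
by apply: contra => /eqP ->; rewrite g0.
Qed.

End MalgMap.

Section OreCorner.
Variables (Gamma : groupType) (R : grRingType Gamma) (gamma : Gamma).
Variables (hgamma : centralizes_grsupp R gamma) (delta : grder R gamma).
Variable l : gridem R.
Hypothesis dl0 : delta (l : R) = 0.

Local Notation S := (ore hgamma delta).
Local Notation T := (ore (corner_centralizes l hgamma) (corner_der l delta)).
Local Notation L := (oreC hgamma delta (l : R)).
Local Notation C := (corner (ore_gridem hgamma delta l)).

(** From [delta l = 0], [delta (l s l) = l (delta s) l]: the sandwiching in the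
    induced derivation has no effect. *)
Lemma corner_derE (s : corner l) : val (corner_der l delta s) = delta (val s).
Proof.
by rewrite /= -[in RHS](corner_sand s) !grderM dl0 mul0r mulr0 add0r addr0.
Qed.

(** Since [t l = l t + delta l] and [delta l = 0], [l] commutes with every
    power of [t]. *)
Lemma oret_exp_idem k :
  iter k (@ore_tmul _ _ _ hgamma delta) L = << (l : R) *g k >>.
Proof.
elim: k => //= k ->; apply: oreP => j; rewrite ore_tmulE !mcoeffU raddfMn dl0.
by rewrite mul0rn addr0; case: j => [|j]; rewrite ?mcoeffU ?eqSS.
Qed.

Lemma ore_sandE (p : S) k :
  (L * p * L : S)@_k = (l : R) * p@_k * (l : R).
Proof.
have -> : L * p = ore_scale (l : R) p by rewrite ore_mulE ore_mulU.
rewrite ore_mulE ore_mul_scale ore_scaleE -mulrA; congr (_ * _).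
rewrite /ore_mul; under eq_bigr do rewrite oret_exp_idem ore_scaleU.
exact: (@malg_mapE _ _ _ (fun c => c * (l : R)) (mul0r _)).
Qed.

Definition ore_val (q : T) : S := malg_map (val : corner l -> R) q.

Lemma ore_valE q k : (ore_val q)@_k = val q@_k.
Proof. exact: malg_mapE. Qed.

Lemma ore_val_corner q : ore_val q \in in_corner (ore_gridem hgamma delta l).
Proof.
by apply/eqP/oreP => k; rewrite ore_sandE ore_valE corner_sand.
Qed.

Definition ore_to_corner (q : T) : C := Corner (ore_val_corner q).

Definition corner_to_ore (p : C) : T := malg_map (corner_proj l) (val p : S).

Lemma corner_to_oreE p k : (corner_to_ore p)@_k = corner_proj l (val p : S)@_k.
Proof. by apply: malg_mapE; apply: val_inj; rewrite /= mulr0 mul0r. Qed.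

Lemma ore_to_cornerK : cancel ore_to_corner corner_to_ore.
Proof.
move=> q; apply: oreP => k; apply: val_inj.
by rewrite corner_to_oreE /= ore_valE corner_sand.
Qed.

Lemma corner_to_oreK : cancel corner_to_ore ore_to_corner.
Proof.
move=> p; apply: val_inj; apply: oreP => k.
by rewrite /= ore_valE corner_to_oreE /= -ore_sandE -[in RHS](corner_sand p).
Qed.

Lemma ore_val_tmul q : ore_val (ore_tmul q) = ore_tmul (ore_val q).
Proof.
apply: oreP => k; rewrite ore_valE !ore_tmulE raddfD.
congr (_ + _); first by case: k => // k; rewrite ore_valE.
by rewrite ore_valE; apply: corner_derE.
Qed.

Lemma ore_val_scale c q : ore_val (ore_scale c q) = ore_scale (val c) (ore_val q).
Proof. by apply: oreP => k; rewrite ore_valE !ore_scaleE ore_valE. Qed.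

Lemma ore_valB : zmod_morphism ore_val.
Proof.
move=> p q; apply: oreP => k.
by rewrite ore_valE mcoeffB raddfB mcoeffB !ore_valE.
Qed.
HB.instance Definition _ := GRing.isZmodMorphism.Build T S ore_val ore_valB.

(** A product is built from scalings and left multiplications by [t], and
    coefficientwise inclusion commutes with both. *)
Lemma ore_valM p q : ore_val (p * q) = ore_val p * ore_val q.
Proof.
rewrite !ore_mulE (ore_mulw _ (msupp_malg_map _ p)) // raddf_sum.
apply: eq_bigr => i _; rewrite /= ore_val_scale ore_valE; congr ore_scale.
by elim: i => //= i <-; rewrite ore_val_tmul.
Qed.

Lemma ore_to_corner_zmod : zmod_morphism ore_to_corner.
Proof. by move=> p q; apply: val_inj; rewrite /= raddfB. Qed.

Lemma ore_to_corner_monoid : monoid_morphism ore_to_corner.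
Proof.
split=> [|p q]; apply: val_inj; last by rewrite /= ore_valM.
apply: oreP => k; rewrite /= ore_valE !mcoeffU.
by case: (0%N == k).
Qed.

HB.instance Definition _ :=
  GRing.isZmodMorphism.Build T C ore_to_corner ore_to_corner_zmod.
HB.instance Definition _ :=
  GRing.isMonoidMorphism.Build T C ore_to_corner ore_to_corner_monoid.

Lemma ore_corner_gr_iso : gr_iso T C.
Proof.
exists (ore_to_corner : {rmorphism T -> C}); split.
  exact: Bijective ore_to_cornerK corner_to_oreK.
move=> sigma q; split=> [h|/corner_compE h].
  by apply/corner_compE => k; rewrite ore_valE; apply/corner_compE/h.
by move=> k; apply/corner_compE; have := h k; rewrite ore_valE.
Qed.

End OreCorner.

Theorem theorem1p9 (Gamma : groupType) (R : grRingType Gamma) (gamma : Gamma)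
    (hgamma : centralizes_grsupp R gamma) (delta : grder R gamma)
    (A : grRingType Gamma) :
  (gr_stably_iso A (ore hgamma delta) ->
     (gr_simple A <-> gr_simple (ore hgamma delta)) /\
     (gr_prime A <-> gr_prime (ore hgamma delta))) /\
  (forall l : gridem R, full_gridem l -> delta (l : R) = 0 ->
     gr_iso A (corner (ore_gridem hgamma delta l)) ->
     gr_iso A (ore (corner_centralizes l hgamma) (corner_der l delta))).
Proof.
split=> [AS | l _ dl0 AC].
  have SA := gr_stably_iso_sym AS.
  by split; split; (exact: gr_stably_iso_simple || exact: gr_stably_iso_prime).
exact: gr_iso_trans AC (gr_iso_sym (ore_corner_gr_iso hgamma dl0)).
Qed.
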